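(* Let $L_\alpha(p)$ be any oblique line, i.e. let $p \in \mathbb{C}$ and $\alpha \in \mathbb{R} \setminus \{0\}$. Let $\rho : \mathbb{R} \to \mathbb{C}$, $\rho(t) := \exp \circ \exp (p + t(i+\alpha))$, and for $T > 1$ let $\mu_T$ be the probability measure on the Riemann sphere $\overline{\mathbb{C}}$ defined by $$\mu_T(A) := \frac{1}{2T} m(\{t \in [-T,T] : \rho(t) \in A\})$$ for every measurable set $A$. Then, in the weak$^*$ topology, $$\lim_{T \to \infty} \mu_T = \frac{\delta_0}{4} + \frac{\delta_1}{2} + \frac{\delta_\infty}{4}.$$
   Context: Here $\exp(z) = e^z$ is the complex exponential, $L_\alpha(p) := \{p + t(i+\alpha) : t \in \mathbb{R}\}$, $m$ denotes one-dimensional Lebesgue measure, $\overline{\mathbb{C}} = \mathbb{C} \cup \{\infty\}$ is the Riemann sphere, and $\delta_z$ denotes the Dirac mass at the point $z \in \overline{\mathbb{C}}$. The space of probability measures on $\overline{\mathbb{C}}$ is equipped with the weak$^*$ topology. *)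

(* Defs.v *)
From HB Require Import structures.
From mathcomp Require Import all_boot all_order all_algebra.
From mathcomp Require Import all_classical all_reals all_analysis.
From mathcomp Require Import measurable_realfun complex ring.

Set Implicit Arguments.
Unset Strict Implicit.
Unset Printing Implicit Defensive.

Import Order.TTheory GRing.Theory Num.Theory.
Import numFieldNormedType.Exports.

Local Open Scope classical_set_scope.
Local Open Scope ring_scope.
Local Open Scope complex_scope.

Definition cexp {R : realType} (z : R[i]) : R[i] :=
  (expR (complex.Re z) * cos (complex.Im z)) +i*
  (expR (complex.Re z) * sin (complex.Im z)).

(* [R[i]^o] carries the topology of the complex modulus; [None] is infinity. *)
Definition riemann_sphere (R : realType) : ptopologicalType :=
  one_point_compactification (R[i]^o).

Definition to_sphere {R : realType} (z : R[i]) : riemann_sphere R := Some z.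

Definition infty {R : realType} : riemann_sphere R := None.

Definition borel (X : ptopologicalType) := g_sigma_algebraType (@open X).

Definition integral_pairing (R : realType) (X : ptopologicalType)
    (mu : probability (borel X) R) : {ptws continuousType X R -> R} :=
  fun f => \int[mu]_x f x.

(* Weak* topology inherited from the dual of [C(X)]: the coarsest topology
   making [mu |-> \int[mu]_x f x] continuous for every continuous [f]. *)
Definition weak_star_probability (R : realType) (X : ptopologicalType) :
    topologicalType :=
  initial_topology (@integral_pairing R X).

Lemma mnormalize_setT1 d (T : measurableType d) (R : realType)
    (m : {measure set T -> \bar R}) (P : probability T R) (A : set T) :
  m setT = 1%E -> mnormalize m P A = m A.
Proof. by move=> m1; rewrite /mnormalize m1 onee_eq0/= invr1 mule1. Qed.

Section Rho.
Context {R : realType}.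
Variables (p : R[i]) (alpha : R).

(* [t |-> p + t (i + alpha)] parametrises the oblique line [L_alpha(p)]. *)
Definition rho (t : R) : R[i] := cexp (cexp (p + t%:C * ('i + alpha%:C))).

Lemma continuous_complex (a b : R -> R) : continuous a -> continuous b ->
  continuous ((fun t => a t +i* b t) : R -> R[i]^o).
Proof.
move=> ca cb t; apply/cvgrPdist_lt => -[e e'].
rewrite ltcE/= => /andP[/eqP -> e0].
have e20 : 0 < e / 2 by rewrite divr_gt0.
have /cvgrPdist_lt/(_ _ e20) Ha := ca t.
have /cvgrPdist_lt/(_ _ e20) Hb := cb t.
near=> s.
have -> : (a t +i* b t) - (a s +i* b s) = (a t - a s)%:C + 'i * (b t - b s)%:C.
  by apply/eqP; rewrite eq_complex/= !mul0r !mul1r !subr0 !addr0 !add0r !eqxx.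
apply: (le_lt_trans (ler_normD _ _)).
rewrite normrM [X in X * _](_ : _ = 1); last first.
  by rewrite normc_def/= expr0n/= expr1n add0r sqrtr1.
rewrite mul1r !normc_def/= !expr0n/= !addr0 !sqrtr_sqr -rmorphD/=.
rewrite ltcE/= eqxx/= [ltRHS]splitr ltrD//.
  by near: s; exact: Ha.
by near: s; exact: Hb.
Unshelve. all: by end_near. Qed.

Lemma continuous_rho : continuous (rho : R -> R[i]^o).
Proof.
pose u t := expR (complex.Re p + t * alpha).
pose v t := complex.Im p + t.
have cw : continuous (fun t : R => complex.Re p + t * alpha).
  move=> t; apply: cvgD; first exact: cvg_cst.
  by apply: cvgM; [exact: cvg_id|exact: cvg_cst].
have cu : continuous u.
  by move=> t; apply: (continuous_comp (cw t)); exact: continuous_expR.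
have cv : continuous v.
  by move=> t; apply: cvgD; [exact: cvg_cst|exact: cvg_id].
have cc : continuous (fun t => u t * cos (v t)).
  move=> t; apply: cvgM; first exact: cu.
  by apply: (continuous_comp (cv t)); exact: continuous_cos.
have cs : continuous (fun t => u t * sin (v t)).
  move=> t; apply: cvgM; first exact: cu.
  by apply: (continuous_comp (cv t)); exact: continuous_sin.
have -> : rho = fun t =>
    (expR (u t * cos (v t)) * cos (u t * sin (v t))) +i*
    (expR (u t * cos (v t)) * sin (u t * sin (v t))).
  apply/funext => t; rewrite /rho /cexp /u /v.
  by case: p => x y /=; rewrite !add0r !addr0 mul0r mul0r subr0 mulr1 addr0.
apply: continuous_complex => t; apply: cvgM.
- by apply: (continuous_comp (cc t)); exact: continuous_expR.
- by apply: (continuous_comp (cs t)); exact: continuous_cos.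
- by apply: (continuous_comp (cc t)); exact: continuous_expR.
- by apply: (continuous_comp (cs t)); exact: continuous_sin.
Qed.

Lemma measurable_rho :
  measurable_fun setT (to_sphere \o rho : R -> borel (riemann_sphere R)).
Proof.
apply: (@measurability _ _ _ (borel (riemann_sphere R)) _ _
  (@open (riemann_sphere R))) => // _ [U oU <-].
rewrite setTI; apply: open_measurable.
have /continuousP : continuous (to_sphere \o rho : R -> riemann_sphere R).
  move=> t; apply: (@continuous_comp _ (R[i]^o)); first exact: continuous_rho.
  exact: one_point_compactification_some_continuous.
exact.
Qed.

(* The occupation measures really are probability measures. *)
Lemma occupation_probability (T : R) : 1 < T ->
  exists mu : probability (borel (riemann_sphere R)) R,
  forall A, measurable A ->
  mu A = ((2 * T)^-1%:E *
    lebesgue_measure [set t | (- T <= t <= T)%R /\ A (to_sphere (rho t))])%E.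
Proof.
move=> T1; have T0 : 0 < T := lt_trans ltr01 T1.
have T2_ge0 : 0 <= (2 * T)^-1 by rewrite invr_ge0 mulr_ge0// ltW.
have mI : measurable (`[- T, T]%classic : set R) by [].
pose m : {measure set (borel (riemann_sphere R)) -> \bar R} :=
  mscale (NngNum T2_ge0)
    (measure_function.measure_function_pushforward__canonical__measure_function_Measure
       (mrestr lebesgue_measure mI) measurable_rho).
have mE A : m A = ((2 * T)^-1%:E *
    lebesgue_measure [set t | (- T <= t <= T)%R /\ A (to_sphere (rho t))])%E.
  by rewrite /m/= /mscale/= /pushforward /mrestr setIC.
have m1 : m setT = 1%E.
  rewrite mE (_ : [set t | _] = `[- T, T]%classic); last first.
    by apply/seteqP; split => t /=; rewrite in_itv/=; [case|].
  rewrite lebesgue_measure_itv/= lte_fin gtrN// -EFinB -EFinM opprK.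
  by congr EFin; field; rewrite gt_eqF.
exists (mnormalize m (dirac (infty : borel (riemann_sphere R)))) => A _.
by rewrite -mE; exact: mnormalize_setT1.
Qed.

End Rho.

Section LimitLaw.
Context (R : realType).
Local Notation S := (borel (riemann_sphere R)).

Definition limit_measure : set S -> \bar R :=
  measure_add
    (measure_add (mscale (4^-1)%:nng (\d_(to_sphere 0 : S)))
                 (mscale (2^-1)%:nng (\d_(to_sphere 1 : S))))
    (mscale (4^-1)%:nng (\d_(infty : S))).

HB.instance Definition _ := Measure.on limit_measure.

Lemma limit_measureE (A : set S) :
  limit_measure A = ((4^-1)%:E * \d_(to_sphere 0%R : S) A +
                 (2^-1)%:E * \d_(to_sphere 1%R : S) A +
                 (4^-1)%:E * \d_(infty : S) A)%E.
Proof.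
by rewrite /limit_measure measure_addE; congr (_ + _)%E; exact: measure_addE.
Qed.

Let limit_measure_setT : limit_measure setT = 1%E.
Proof.
rewrite limit_measureE !diracT !mule1 -!EFinD.
by congr EFin; field.
Qed.

HB.instance Definition _ :=
  Measure_isProbability.Build _ _ _ limit_measure limit_measure_setT.

Definition limit_law : probability S R := limit_measure.

End LimitLaw.

(* Main.v *)
Require Import Defs.
From HB Require Import structures.
From mathcomp Require Import all_boot all_order all_algebra.
From mathcomp Require Import all_classical all_reals all_analysis.
From mathcomp Require Import complex.
From mathcomp Require Import measurable_realfun ring lra.
Import Order.TTheory GRing.Theory Num.Theory.
Import numFieldNormedType.Exports.
Local Open Scope classical_set_scope.
Local Open Scope ring_scope.
Local Open Scope complex_scope.

(** Weak* convergence means convergence of the integral of every continuous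
    function [f] on the sphere ([cvg_initial], [cvg_ptws]); such an [f] is
    bounded because the sphere is compact. The integral of [f] against [mu T]
    is the mean of [f (rho t)] over [[-T, T]] ([integral_occupation]), that is,
    the average of the means over [0, T] of [f (rho t)] and of [f (rho (- t))].
    It remains to find the limits of these two means.

    Write [p = a + i b]. The inner exponential at time [t] is the number of
    modulus [exp (a + alpha t)] and argument [b + t], and the modulus of
    [rho t] is the exponential of its real part
    [exp (a + alpha t) * cos (b + t)].
    On the half-line where [alpha t] tends to [-oo], the inner exponential
    tends to [0], so [rho t] tends to [1] and the mean tends to [f 1]
    ([mean_contracting]). On the other half-line, [rho t] is very close to
    [infty] or to [0] according to the sign of [cos (b + t)], except near the
    zeros of the cosine, and the mean tends to [(f 0 + f infty) / 2]
    ([mean_expanding]). Averaging both half-lines gives the weights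
    1/4, 1/2, 1/4.

    On the expanding half-line, [rho t] has no limit, but the cosine changes
    sign when [t] increases by [pi]. For almost every [s] in [[0, pi]], the sum
    of the values of [f (rho t)] at [s + 2 n pi] and [s + (2 n + 1) pi]
    therefore tends to [f 0 + f infty]. By dominated convergence the integrals
    over the successive periods of length [2 pi] converge, and their Cesaro
    means are, up to a bounded error, the integrals over [0, T]
    ([mean_of_alternating_translates], [mean_of_increments]). *)

(** * Long-time means *)

(** The means of the increments converge by Cesaro, which gives the limit of
    [Phi T / T] along the multiples of the period [P]; by the Lipschitz bound
    [Phi] varies by at most [M * P] within a period, which is negligible after
    division by [T]. *)
Lemma mean_of_increments (R : realType) (Phi : R -> R) (M P L : R) :
  0 < P -> Phi 0 = 0 ->
  (forall x y, 0 <= x -> x <= y -> `|Phi y - Phi x| <= M * (y - x)) ->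
  (fun n : nat => Phi (n.+1%:R * P) - Phi (n%:R * P)) @ \oo --> L ->
  (fun T => T^-1 * Phi T) @ +oo --> L / P.
Proof.
move=> P0 Phi0 lipPhi incL.
have M0 : 0 <= M.
  by have := lipPhi 0 1 (lexx _) ler01; rewrite subr0 mulr1; exact: le_trans.
have meanL : (fun n : nat => n.+1%:R^-1 * Phi (n.+1%:R * P)) @ \oo --> L.
  have -> : (fun n : nat => n.+1%:R^-1 * Phi (n.+1%:R * P)) =
      arithmetic_mean (fun n : nat => Phi (n.+1%:R * P) - Phi (n%:R * P)).
    apply/funext => n; rewrite /arithmetic_mean/= /series/=.
    rewrite (telescope_sumr (fun i : nat => Phi (i%:R * P)))//.
    by rewrite mul0r Phi0 subr0.
  exact: cesaro.
apply/cvgrPdist_le => /= e e0.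
have eP0 : 0 < e * P / 2 by rewrite divr_gt0// mulr_gt0.
have /cvgrPdist_le/(_ _ eP0)[N _ HN] := meanL.
near=> T.
have T0 : 0 < T by near: T; exact: nbhs_pinfty_gt.
have TP0 : 0 <= T / P by rewrite divr_ge0// ltW.
(* [n] is the number of full periods in [0, T]. *)
pose n := Num.truncn (T / P).
have /andP[] := Num.Theory.truncn_itv TP0; rewrite -/n ler_pdivlMr// ltr_pdivrMr//.
move=> nT Tn.
have Nn : (N < n)%N.
  by rewrite /n truncn_gt_nat ler_pdivlMr.
have n0 : (0 < n)%N := leq_ltn_trans (leq0n _) Nn.
have nP0 : 0 <= n%:R * P by rewrite mulr_ge0// ltW.
have H1 : `|Phi T - Phi (n%:R * P)| <= M * P.
  apply: (le_trans (lipPhi _ _ nP0 nT)); rewrite ler_wpM2l//.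
  rewrite lerBlDr; apply: ltW; apply: (lt_le_trans Tn).
  by rewrite -natr1 mulrDl mul1r addrC.
have H2 : `|n%:R * L - Phi (n%:R * P)| <= n%:R * (e * P / 2).
  have := HN n.-1; rewrite /= -ltnS prednK// => /(_ Nn) H.
  have nr0 : n%:R != 0 :> R by rewrite pnatr_eq0 -lt0n.
  have -> : n%:R * L - Phi (n%:R * P) = n%:R * (L - n%:R^-1 * Phi (n%:R * P)).
    by rewrite mulrBr mulrA divff// mul1r.
  by rewrite normrM (@ger0_norm _ n%:R)// ler_wpM2l.
have H3 : `|T / P * L - n%:R * L| <= `|L|.
  rewrite -mulrBl normrM ler_piMl// ger0_norm; last first.
    by rewrite subr_ge0 ler_pdivlMr.
  by rewrite lerBlDr addrC natr1 ltW// ltr_pdivrMr.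
have -> : L / P - T^-1 * Phi T = T^-1 * (T / P * L - Phi T).
  by rewrite mulrBr; congr (_ - _); field; rewrite !gt_eqF.
rewrite normrM (@ger0_norm _ T^-1) ?invr_ge0 ?(ltW T0)// ler_pdivrMl//.
have -> : T / P * L - Phi T = (T / P * L - n%:R * L) +
    (n%:R * L - Phi (n%:R * P)) - (Phi T - Phi (n%:R * P)) by ring.
apply: (le_trans (ler_normB _ _)).
apply: (@le_trans _ _ ((`|L| + n%:R * (e * P / 2)) + M * P)).
  by apply: lerD => //; apply: (le_trans (ler_normD _ _)); exact: lerD.
have H4 : `|L| + M * P <= T * (e / 2).
  by rewrite -ler_pdivrMr ?divr_gt0.
have H5 : n%:R * (e * P / 2) <= T * (e / 2).
  have -> : n%:R * (e * P / 2) = n%:R * P * (e / 2) by ring.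
  by rewrite ler_wpM2r// divr_ge0// ltW.
have -> : T * e = T * (e / 2) + T * (e / 2) by field.
by rewrite addrAC lerD.
Unshelve. all: by end_near. Qed.

Section integrals_of_continuous_functions.
Context {R : realType}.
Local Notation leb := (@lebesgue_measure R).
Implicit Types (g : R -> R) (a b c x l M : R).

Lemma continuous_integrable_itv {g} a b : continuous g ->
  leb.-integrable `[a, b] (EFin \o g).
Proof.
move=> cg; apply: continuous_compact_integrable; first exact: segment_compact.
exact: continuous_subspaceT.
Qed.

Lemma Rintegral_translate g x c : continuous g -> 0 <= c ->
  \int[leb]_(t in `[x, x + c]) g t = \int[leb]_(s in `[0, c]) g (x + s).
Proof.
move=> cg c0; have dF : derive1 (fun s : R => x + s) = cst 1.
  apply/funext => s; rewrite derive1E deriveD//=.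
  by rewrite derive_cst derive_id add0r.
have cF : continuous (fun s => x + s).
  by move=> s; apply: cvgD; [exact: cvg_cst|exact: cvg_id].
have := @integration_by_substitution_increasing R (fun s => x + s) g 0 c c0.
rewrite addr0 /Rintegral => ->//.
- congr fine; apply: eq_integral => s _.
  by rewrite !fctE dF mulr1.
- by move=> ? ? _ _; rewrite ltrD2l.
- by rewrite dF => ? _; exact: cvg_cst.
- by rewrite dF; exact: is_cvg_cst.
- by rewrite dF; exact: is_cvg_cst.
- split.
  + by move=> s _; apply: derivableD => //; exact: derivable_id.
  + by apply: cvg_at_right_filter; exact: cF.
  + by apply: cvg_at_left_filter; exact: cF.
- exact: continuous_subspaceT.
Qed.

Lemma Rintegral_itv_norm_le g M a b : continuous g ->
  (forall x, `|g x| <= M) -> a <= b ->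
  `|\int[leb]_(t in `[a, b]) g t| <= M * (b - a).
Proof.
move=> cg gM ab.
apply: (le_trans (le_normr_Rintegral _ (continuous_integrable_itv a b cg))) => //.
have -> : M * (b - a) = \int[leb]_(t in `[a, b]) M.
  rewrite Rintegral_cst//= lebesgue_measure_itv/= lte_fin.
  by case: ltgtP ab => //= -> _; rewrite subrr.
apply: le_Rintegral => //.
- by apply: continuous_integrable_itv => x; apply: cvg_norm; exact: cg.
- by apply: continuous_integrable_itv => x; exact: cvg_cst.
Qed.

Lemma Rintegral_itv_split g a b c : continuous g -> a <= b -> b <= c ->
  \int[leb]_(t in `[a, c]) g t - \int[leb]_(t in `[a, b]) g t =
  \int[leb]_(t in `[b, c]) g t.
Proof.
move=> cg ab bc; rewrite Rintegral_itvB ?bnd_simp//; last first.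
  exact: continuous_integrable_itv.
rewrite Rintegral_itv_obnd_cbnd//.
apply: (integrableS _ _ _ (continuous_integrable_itv b c cg)) => //.
exact: subset_itv_oc_cc.
Qed.

(** The limit may fail to exist along [s + k * c] for every single [s], as long
    as the values at two consecutive steps have a sum that settles down: this
    is what happens along a path that is alternately attracted by two points.
    The integral of [g] over the period [[2 n c, 2 (n + 1) c]] is the integral
    over [[0, c]] of the sum of the two translates, and dominated convergence
    applies to it although the convergence is not uniform in [s]. *)
Lemma mean_of_alternating_translates g M c l : continuous g ->
  (forall x, `|g x| <= M) -> 0 < c ->
  {ae leb, forall s, `[0, c]%classic s ->
    (fun n : nat => g (s + n.*2%:R * c) + g (s + n.*2.+1%:R * c)) @ \oo --> l} ->
  (fun T => T^-1 * \int[leb]_(t in `[0, T]) g t) @ +oo --> l / 2.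
Proof.
move=> cg gM c0 gl.
have cgD x : continuous (fun s => g (x + s)).
  move=> s; apply: continuous_comp; last exact: cg.
  by apply: cvgD; [exact: cvg_cst|exact: cvg_id].
pose G (n : nat) s := g (s + n.*2%:R * c) + g (s + n.*2.+1%:R * c).
have cG n : continuous (G n).
  move=> s; apply: cvgD; under eq_fun do rewrite addrC; rewrite addrC; exact: cgD.
have -> : l / 2 = (c * l) / (2 * c) by field; rewrite gt_eqF.
apply: (@mean_of_increments R (fun T => \int[leb]_(t in `[0, T]) g t) M).
- by rewrite mulr_gt0.
- by rewrite set_itv1 Rintegral_set1.
- move=> x y x0 xy; rewrite Rintegral_itv_split//.
  exact: Rintegral_itv_norm_le.
have -> : (fun n : nat => \int[leb]_(t in `[0, (n.+1%:R * (2 * c))%R]) g t -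
      \int[leb]_(t in `[0, (n%:R * (2 * c))%R]) g t) =
    (fun n => \int[leb]_(s in `[0, c]) G n s).
  apply/funext => n.
  have n0 : 0 <= n%:R * (2 * c) by rewrite !mulr_ge0// ltW.
  have -> : n.+1%:R * (2 * c) = n%:R * (2 * c) + c + c.
    by rewrite -natr1; ring.
  rewrite Rintegral_itv_split//; last by rewrite -addrA lerDl addr_ge0// ltW.
  rewrite -[LHS](subrK (\int[leb]_(t in `[n%:R * (2 * c), n%:R * (2 * c) + c]) g t)).
  rewrite Rintegral_itv_split ?lerDl ?ltW//.
  rewrite !Rintegral_translate ?ltW//.
  rewrite -RintegralD//; [|exact: continuous_integrable_itv..].
  apply: eq_Rintegral => s _; rewrite /G addrC; congr (g _ + g _).
    by rewrite -muln2 natrM; ring.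
  by rewrite -[n.*2.+1]addn1 natrD -muln2 natrM; ring.
have intG n := continuous_integrable_itv 0 c (cG n).
have cstI (k : R) : leb.-integrable `[0, c] (EFin \o cst k).
  by apply: continuous_integrable_itv => x; exact: cvg_cst.
have [] := @dominated_convergence _ _ R leb `[0, c]%classic (measurable_itv _)
  (fun n s => (G n s)%:E) (EFin \o cst l) (EFin \o cst (M + M)).
- by move=> n; exact: measurable_int (intG n).
- exact: measurable_int (cstI l).
- apply: (@filterS _ _ (ae_filter_ringOfSetsType leb) _ _ _ gl) => s gls /gls gsl.
  by apply: cvg_EFin gsl; exact: nearW.
- exact: cstI.
- apply: aeW => s n _; rewrite lee_fin; apply: (le_trans (ler_normD _ _)).
  exact: lerD.
move=> _ _; rewrite -[X in _ --> X -> _]fineK; last first.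
  by apply: integrable_fin_num => //; exact: cstI.
move=> /fine_cvg; set r := fine _.
have -> : r = c * l.
  rewrite /r -/(Rintegral leb _ _) Rintegral_cst//= lebesgue_measure_itv/=.
  by rewrite lte_fin c0/= subr0 mulrC.
exact.
Qed.

End integrals_of_continuous_functions.

(** * Limits of the complex exponential on the sphere *)

(** The norm of [R[i]] takes its values in [R[i]]; the modulus is its real
    counterpart, needed to speak of limits at [+oo]. *)
Definition modulus {R : realType} (z : R[i]) : R := complex.Re `|z|.

Section complex_exponential_limits.
Context {R : realType}.
Implicit Types (z : R[i]).

Lemma modulusE z : `|z| = (modulus z)%:C.
Proof. by rewrite /modulus normc_def. Qed.

Lemma modulus_cexp z : modulus (cexp z) = expR (complex.Re z).
Proof.
rewrite /modulus /cexp normc_def/= !exprMn -mulrDr cos2Dsin2 mulr1 sqrtr_sqr.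
by rewrite ger0_norm// expR_ge0.
Qed.

Lemma continuous_modulus : continuous (modulus : R[i]^o -> R).
Proof.
move=> z; have Fz : Filter (nbhs (z : R[i]^o)) := nbhs_filter _.
apply/(@cvgrPdist_lt _ _ _ _ (fmap_filter _ Fz)) => e e0.
have eC : 0 < e%:C by rewrite ltcR.
have := @cvgr_dist_lt _ (R[i]^o) _ (nbhs (z : R[i]^o)) _ id z cvg_id _ eC.
move=> /(_ Fz); refine (@filterS _ _ Fz _ _ _) => y /=.
rewrite -ltcR; apply: le_lt_trans.
have -> : `|modulus z - modulus y|%:C = `| `|z| - `|y| |.
  by rewrite (modulusE z) (modulusE y) -rmorphB/= normc_def/= expr0n/= addr0 sqrtr_sqr.
exact: ler_dist_dist.
Qed.

Context {T : Type} {F : set_system T} {FF : Filter F}.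
Implicit Types (w : T -> R[i]) (a b : T -> R).

Lemma cvg_complex a b (x y : R) : a @ F --> x -> b @ F --> y ->
  (fun t => a t +i* b t : R[i]^o) @ F --> (x +i* y : R[i]^o).
Proof.
move=> ax yb; apply/cvgrPdist_lt => -[e e'].
rewrite ltcE/= => /andP[/eqP -> e0].
have e20 : 0 < e / 2 by rewrite divr_gt0.
have /cvgrPdist_lt/(_ _ e20) Ha := ax.
have /cvgrPdist_lt/(_ _ e20) Hb := yb.
near=> s.
have -> : (x +i* y) - (a s +i* b s) = (x - a s)%:C + 'i * (y - b s)%:C.
  by apply/eqP; rewrite eq_complex/= !mul0r !mul1r !subr0 !addr0 !add0r !eqxx.
apply: (le_lt_trans (ler_normD _ _)).
rewrite normrM [X in X * _](_ : _ = 1); last first.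
  by rewrite normc_def/= expr0n/= expr1n add0r sqrtr1.
rewrite mul1r !normc_def/= !expr0n/= !addr0 !sqrtr_sqr -rmorphD/=.
rewrite ltcE/= eqxx/= [ltRHS]splitr ltrD//.
  by near: s; exact: Ha.
by near: s; exact: Hb.
Unshelve. all: by end_near. Qed.

Lemma modulus_cvg0 w : modulus \o w @ F --> (0 : R) ->
  (w : T -> R[i]^o) @ F --> (0 : R[i]^o).
Proof.
move=> w0; apply/cvgrPdist_lt => -[e e'].
rewrite ltcE/= => /andP[/eqP -> e0].
have /cvgrPdist_lt/(_ _ e0) := w0.
apply: filterS => t /=; rewrite !sub0r normrN normrN modulusE ltcR.
exact: le_lt_trans (ler_norm _).
Qed.

(** A compact set of complex numbers has bounded modulus, so that a path whose
    modulus tends to [+oo] leaves it eventually. *)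
Lemma modulus_cvgy w : modulus \o w @ F --> +oo ->
  to_sphere \o w @ F --> (infty : riemann_sphere R).
Proof.
move=> woo A [K [cK _] KA].
have : compact (modulus @` K).
  apply: (@continuous_compact (R[i]^o) R) cK.
  exact: continuous_subspaceT continuous_modulus.
move=> /compact_bounded[B [Breal HB]].
have /cvgryPgt/(_ (B + 1)) := woo.
apply: filterS => t /= Bt; apply: KA; left; exists (w t) => //= Kt.
have HB1 : `|modulus (w t)| <= B + 1.
  by apply: (HB (B + 1)); [rewrite ltrDl|exists (w t)].
by have := lt_le_trans Bt (le_trans (ler_norm _) HB1); rewrite ltxx.
Qed.

Lemma cexp_cvg_infty w : (fun t => complex.Re (w t)) @ F --> +oo ->
  (fun t => to_sphere (cexp (w t))) @ F --> (infty : riemann_sphere R).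
Proof.
move=> woo; apply: (@modulus_cvgy (fun t => cexp (w t))).
have -> : modulus \o (fun t => cexp (w t)) = fun t => expR (complex.Re (w t)).
  by apply/funext => t; rewrite /= modulus_cexp.
apply: (ger_cvgy _ woo); apply: nearW => t.
by apply: le_trans (expR_ge1Dx _); rewrite lerDr.
Qed.

Lemma cexp_cvg0 w : (fun t => complex.Re (w t)) @ F --> -oo ->
  (fun t => to_sphere (cexp (w t))) @ F --> (to_sphere 0 : riemann_sphere R).
Proof.
move=> woo.
apply: (@cvg_comp _ (R[i]^o) (riemann_sphere R) (fun t => cexp (w t)) to_sphere); last first.
  exact: one_point_compactification_some_continuous.
apply: modulus_cvg0.
have -> : modulus \o (fun t => cexp (w t)) = fun t => expR (complex.Re (w t)).
  by apply/funext => t; rewrite /= modulus_cexp.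
have -> : (fun t => expR (complex.Re (w t))) =
    (fun x => expR (- x)) \o (- (fun t => complex.Re (w t))).
  by apply/funext => t /=; rewrite fctE opprK.
exact: cvg_comp (iffRL (cvgNry _) woo) (@cvgr_expR R).
Qed.

Lemma cexp_cvg1 w : (fun t => complex.Re (w t)) @ F --> (0 : R) ->
  (fun t => complex.Im (w t)) @ F --> (0 : R) ->
  (fun t => to_sphere (cexp (w t))) @ F --> (to_sphere 1 : riemann_sphere R).
Proof.
move=> wr wi.
apply: (@cvg_comp _ (R[i]^o) (riemann_sphere R) (fun t => cexp (w t)) to_sphere); last first.
  exact: one_point_compactification_some_continuous.
have -> : (1 : R[i]) = (expR 0 * cos 0) +i* (expR 0 * sin 0).
  by rewrite expR0 cos0 sin0 mulr1 mulr0.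
apply: cvg_complex; apply: cvgM.
- exact: cvg_comp wr (@continuous_expR R 0).
- exact: cvg_comp wi (@continuous_cos R 0).
- exact: cvg_comp wr (@continuous_expR R 0).
- exact: cvg_comp wi (@continuous_sin R 0).
Qed.

End complex_exponential_limits.

(** * Behaviour of the path along the line *)

Section line_asymptotics.
Context {R : realType} (p : R[i]) (alpha : R).
Local Notation cexp_line t := (cexp (p + t%:C * ('i + alpha%:C))).

Lemma Re_cexp_line t :
  complex.Re (cexp_line t) = expR (complex.Re p + alpha * t) * cos (complex.Im p + t).
Proof.
by case: p => x y /=; rewrite !add0r !addr0 !mul0r subr0 mulr1 addr0 (mulrC t).
Qed.

Lemma Im_cexp_line t :
  complex.Im (cexp_line t) = expR (complex.Re p + alpha * t) * sin (complex.Im p + t).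
Proof.
by case: p => x y /=; rewrite !add0r !addr0 !mul0r subr0 mulr1 addr0 (mulrC t).
Qed.

Context {T : Type} {F : set_system T} {FF : Filter F}.
Implicit Types x : T -> R.

Lemma cvg_expR_speed x : (fun t => alpha * x t) @ F --> +oo ->
  (fun t => expR (complex.Re p + alpha * x t)) @ F --> +oo.
Proof.
move=> /cvgryPge xoo; apply/cvgryPge => A.
apply: filterS (xoo (A - complex.Re p)) => t; rewrite lerBlDl => /le_trans; apply.
by apply: le_trans (expR_ge1Dx _); rewrite lerDr.
Qed.

(** The argument of the outer exponential has real part
    [exp (Re p + alpha * t) * cos (Im p + t)], so its sign is that of the
    cosine. Fixing the value of the cosine along the family [x] is enough here,
    because [x] will run through points that differ by multiples of [2 pi]. *)
Lemma rho_cvg_infty x c : (fun t => alpha * x t) @ F --> +oo -> 0 < c ->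
  (forall t, cos (complex.Im p + x t) = c) ->
  (fun t => to_sphere (rho p alpha (x t))) @ F --> (infty : riemann_sphere R).
Proof.
move=> /cvg_expR_speed xoo c0 xc; apply: cexp_cvg_infty.
under eq_fun do rewrite Re_cexp_line xc.
exact: cvg_comp xoo (gt0_cvgMly c0 cvg_id).
Qed.

Lemma rho_cvg0 x c : (fun t => alpha * x t) @ F --> +oo -> c < 0 ->
  (forall t, cos (complex.Im p + x t) = c) ->
  (fun t => to_sphere (rho p alpha (x t))) @ F --> (to_sphere 0 : riemann_sphere R).
Proof.
move=> /cvg_expR_speed xoo c0 xc; apply: cexp_cvg0.
under eq_fun do rewrite Re_cexp_line xc.
apply/cvgNry; rewrite (_ : - _ = fun t => expR (complex.Re p + alpha * x t) * (- c)).
  by apply: cvg_comp xoo (gt0_cvgMly _ cvg_id); rewrite oppr_gt0.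
by apply/funext => t; rewrite fctE mulrN.
Qed.

(** At the other end of the line the inner exponential tends to [0], whatever
    its argument. *)
Lemma rho_cvg1 x : (fun t => alpha * x t) @ F --> -oo ->
  (fun t => to_sphere (rho p alpha (x t))) @ F --> (to_sphere 1 : riemann_sphere R).
Proof.
move=> xoo; have e0 : (fun t => expR (complex.Re p + alpha * x t)) @ F --> (0 : R).
  have -> : (fun t => expR (complex.Re p + alpha * x t)) =
      (fun z => expR (- z)) \o (fun t => - alpha * x t - complex.Re p).
    by apply/funext => t /=; congr expR; ring.
  apply: cvg_comp (@cvgr_expR R); apply/cvgryPge => A.
  move/cvgrNyPle : xoo => /(_ (- (A + complex.Re p))).
  by apply: filterS => t; lra.
have bounded_mul0 (g : R -> R) : (forall t, `|g t| <= 1) ->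
    (fun t => expR (complex.Re p + alpha * x t) * g (complex.Im p + x t)) @ F
      --> (0 : R).
  move=> g1; apply/norm_cvg0P; apply: (squeeze_cvgr _ (cvg_cst 0) e0).
  apply: nearW => t /=; rewrite normr_ge0 normrM ger0_norm ?expR_ge0//=.
  by rewrite ler_piMr ?expR_ge0.
apply: cexp_cvg1.
- by under eq_fun do rewrite Re_cexp_line; apply: bounded_mul0; exact: cos_max.
- by under eq_fun do rewrite Im_cexp_line; apply: bounded_mul0; exact: sin_max.
Qed.

End line_asymptotics.

(** * Integration and weak convergence *)

Lemma integral_mscale d (T : measurableType d) (R : realType)
    (m : {measure set T -> \bar R}) (k : {nonneg R}) (D : set T)
    (f : T -> \bar R) : measurable D -> m.-integrable D f ->
  (\int[mscale k m]_(x in D) f x = k%:num%:E * \int[m]_(x in D) f x)%E.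
Proof.
move=> mD intf; have mf := measurable_int m intf.
rewrite (integralE (mscale k m)) (integralE m).
rewrite ge0_integral_mscale//; last exact: measurable_funepos.
rewrite ge0_integral_mscale//; last exact: measurable_funeneg.
rewrite -muleBr// fin_num_adde_defl// fin_numN.
exact: integrable_neg_fin_num.
Qed.

Lemma cvg_initial {S : choiceType} {X : topologicalType} (h : S -> X)
    {T : Type} {F : set_system T} {FF : Filter F} (g : T -> S) (x : S) :
  h \o g @ F --> h x -> g @ F --> (x : initial_topology h).
Proof.
move=> hg A /= [_ [[B oB <-] Bhx] BA].
have FB : F ((h \o g) @^-1` B) by apply: hg; exact: open_nbhs_nbhs.
exact: (@filterS _ F FF _ _ (fun t Bt => BA (g t) Bt) FB).
Qed.

Lemma cvg_ptws {I : Type} {V : uniformType} {T : Type} {F : set_system T}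
    {FF : Filter F} (g : T -> {ptws I -> V}) (h : {ptws I -> V}) :
  (forall i, (fun t => g t i) @ F --> h i) -> g @ F --> h.
Proof.
by move=> gh; apply/cvg_sup => i; apply: (cvg_initial (fun u : I -> V => u i)) (gh i).
Qed.

Section integrability_of_continuous_functions.
Context {R : realType} {X : ptopologicalType}.

Lemma continuous_borel_measurable (f : X -> R) : continuous f ->
  measurable_fun setT (f : borel X -> R).
Proof.
move=> cf; apply: (measurability _ (RGenOpens.measurableE R)) => //.
move=> _ [_ [a [b ->] <-]]; rewrite setTI; apply: sub_sigma_algebra.
by move/continuousP: cf; apply; exact: interval_open.
Qed.

Lemma compact_continuous_bounded (f : X -> R) : compact [set: X] ->
  continuous f -> exists M : R, forall x, `|f x| <= M.
Proof.
move=> cX cf; have : compact (f @` setT).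
  by apply: continuous_compact => //; exact: continuous_subspaceT.
move=> /compact_bounded[B [_ HB]]; exists (B + 1) => x.
by apply: (HB (B + 1)); [rewrite ltrDl|exists x].
Qed.

Lemma bounded_borel_integrable (m : {measure set (borel X) -> \bar R})
    (f : X -> R) M : (m setT < +oo)%E -> continuous f -> (forall x, `|f x| <= M) ->
  m.-integrable setT (EFin \o (f : borel X -> R)).
Proof.
move=> moo cf fM; apply: measurable_bounded_integrable => //.
- exact: continuous_borel_measurable.
- exists M; split; first exact: num_real.
  by move=> y My x _; exact: le_trans (fM x) (ltW My).
Qed.

End integrability_of_continuous_functions.

(** * Means along the two half-lines *)

Section half_lines.
Context {R : realType} (p : R[i]) (alpha : R).
Variables (f : riemann_sphere R -> R) (M : R).
Hypotheses (cf : continuous f) (fM : forall x, `|f x| <= M).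
Local Notation leb := (@lebesgue_measure R).
Local Notation S := (riemann_sphere R).

Lemma continuous_f_rho (s : R) :
  continuous (fun t => f (to_sphere (rho p alpha (s * t)))).
Proof.
move=> t; apply: (@continuous_comp _ S R (fun t => to_sphere (rho p alpha (s * t))) f);
  last exact: cf.
apply: (@continuous_comp _ (R[i]^o) S (fun t => rho p alpha (s * t)) to_sphere); last first.
  exact: one_point_compactification_some_continuous.
apply: (@continuous_comp _ R (R[i]^o) (fun t => s * t) (rho p alpha)).
  by apply: cvgM; [exact: cvg_cst|exact: cvg_id].
exact: continuous_rho.
Qed.

Lemma cvg_f_comp {T : Type} {F : set_system T} {FF : Filter F} (z : T -> S) (x : S) :
  z @ F --> x -> (fun t => f (z t)) @ F --> f x.
Proof. by move=> zx; apply: (@cvg_comp _ S R z f _ _ _ zx); exact: cf. Qed.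

(* The point [s * t] with [t >= 0] runs through one half-line or the other
   according to the sign [s]. *)
Variable s : R.
Hypothesis s2 : s ^+ 2 = 1.

Let s_cases : s = 1 \/ s = -1.
Proof.
move/eqP: s2; rewrite -[X in _ == X](expr1n _ 2) eqf_sqr => /orP[]/eqP ->; first by left.
by right.
Qed.

Lemma cos_half_turns b x n : cos (b + s * (x + n%:R * pi)) = (-1) ^+ n * cos (b + s * x).
Proof.
elim: n => [|n IH]; first by rewrite mul0r addr0 mul1r.
rewrite exprS -mulrA -IH mulN1r; case: s_cases => ->.
  by rewrite -cosDpi; congr cos; rewrite -natr1; ring.
by rewrite -[LHS]opprK -[in LHS]cosDpi; congr (- cos _); rewrite -natr1; ring.
Qed.

(** If the cosine vanishes at [x] and [y], then [sin (y - x) = 0]; hence it has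
    at most one zero in the open interval, and the exceptional set is contained
    in a set of three points. *)
Lemma ae_cos_neq0 b : {ae leb, forall x, `[0, pi]%classic x -> cos (b + s * x) != 0}.
Proof.
pose E := [set x : R | 0 < x < pi /\ cos (b + s * x) = 0].
have E1 x y : E x -> E y -> x <= y -> x = y.
  move=> [/andP[x0 xpi] cx] [/andP[y0 ypi] cy]; rewrite le_eqVlt => /predU1P[//|xy].
  have : sin (y - x) = 0.
    have : sin ((b + s * y) - (b + s * x)) = 0 by rewrite sinB cx cy mulr0 mul0r subrr.
    rewrite (_ : _ - _ = s * (y - x)); last by ring.
    by case: s_cases => ->; rewrite ?mul1r// mulN1r sinN => /eqP;
       rewrite oppr_eq0 => /eqP.
  have : 0 < sin (y - x) by apply: sin_gt0_pi; lra.
  by move=> /gt_eqF/eqP.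
pose N := [set 0] `|` [set pi] `|` [set xget 0 E].
have cN : countable N.
  by apply: finite_set_countable; rewrite !finite_setU; do !split; exact: finite_set1.
exists N; split.
- exact: countable_measurable.
- exact: countable_lebesgue_measure0.
- move=> x /= /not_implyP[]; rewrite in_itv/= => /andP[x0 xpi] /negP.
  rewrite negbK => /eqP cx.
  have [->|xn0] := eqVneq x 0; first by left; left.
  have [->|xnpi] := eqVneq x pi; first by left; right.
  have Ex : E x by split => //; rewrite !lt_neqAle x0 xpi eq_sym xn0 xnpi.
  right => /=; have Eg : E (xget 0 E) := xgetPex 0 (ex_intro _ x Ex).
  have [xE|/ltW xE] := leP x (xget 0 E); first exact: E1.
  by apply/esym; exact: E1.
Qed.

Lemma cvg_half_turns x (k : nat -> nat) : (forall n, (n <= k n)%N) ->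
  (fun n => x + (k n)%:R * pi : R) @ \oo --> +oo.
Proof.
move=> nk; apply/cvgryPge => A.
exists (Num.truncn ((A - x) / pi)).+1 => // n /= An.
rewrite -lerBlDl -ler_pdivrMr ?pi_gt0//.
apply: (le_trans (ltW (Num.Theory.truncnS_gt _))).
by rewrite ler_nat; exact: leq_trans An (nk n).
Qed.

(** Moving by a half-turn [pi] changes the sign of the cosine. Hence, for almost
    every starting point [x], one of [x + 2 n pi] and [x + (2 n + 1) pi] is sent
    near [infty] and the other one near [0] when [n] is large: the sum of the
    two values of [f] always tends to [f 0 + f infty], irrespective of the sign
    at [x]. *)
Lemma mean_expanding : 0 < alpha * s ->
  (fun T => T^-1 * \int[leb]_(t in `[0, T]) f (to_sphere (rho p alpha (s * t))))
    @ +oo --> (f (to_sphere 0) + f infty) / 2.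
Proof.
move=> as0.
apply: (@mean_of_alternating_translates _ _ M pi _ (continuous_f_rho s)) => //.
  exact: pi_gt0.
apply: (@filterS _ _ (ae_filter_ringOfSetsType leb) _ _ _ (ae_cos_neq0 (complex.Im p))).
move=> x /[apply] cx0.
have speed (k : nat -> nat) : (forall n, (n <= k n)%N) ->
    (fun n => alpha * (s * (x + (k n)%:R * pi))) @ \oo --> +oo.
  move=> nk.
  rewrite (_ : (fun n => _) = fun n => (x + (k n)%:R * pi) * (alpha * s)); last first.
    by apply/funext => n; ring.
  exact: cvg_comp (cvg_half_turns x k nk) (gt0_cvgMly as0 cvg_id).
have ev n : (n <= n.*2)%N by rewrite -addnn leq_addr.
have od n : (n <= n.*2.+1)%N by rewrite leqW.
have cev n : cos (complex.Im p + s * (x + n.*2%:R * pi)) = cos (complex.Im p + s * x).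
  by rewrite cos_half_turns -signr_odd odd_double mul1r.
have cod n : cos (complex.Im p + s * (x + n.*2.+1%:R * pi)) =
    - cos (complex.Im p + s * x).
  by rewrite cos_half_turns -signr_odd/= odd_double mulN1r.
have [c0|c0] : cos (complex.Im p + s * x) < 0 \/ 0 < cos (complex.Im p + s * x).
  by move: cx0; rewrite neq_lt => /orP[]; [left|right].
- apply: cvgD; apply: cvg_f_comp.
  + exact: rho_cvg0 _ _ _ _ (speed _ ev) c0 cev.
  + by apply: rho_cvg_infty _ _ _ _ (speed _ od) _ cod; rewrite oppr_gt0.
- rewrite addrC; apply: cvgD; apply: cvg_f_comp.
  + exact: rho_cvg_infty _ _ _ _ (speed _ ev) c0 cev.
  + by apply: rho_cvg0 _ _ _ _ (speed _ od) _ cod; rewrite oppr_lt0.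
Qed.

Lemma mean_contracting : alpha * s < 0 ->
  (fun T => T^-1 * \int[leb]_(t in `[0, T]) f (to_sphere (rho p alpha (s * t))))
    @ +oo --> f (to_sphere 1).
Proof.
move=> as0; rewrite (_ : f _ = (f (to_sphere 1) + f (to_sphere 1)) / 2); last by field.
apply: (@mean_of_alternating_translates _ _ M pi _ (continuous_f_rho s)) => //.
  exact: pi_gt0.
apply: aeW => x _.
have speed (k : nat -> nat) : (forall n, (n <= k n)%N) ->
    (fun n => alpha * (s * (x + (k n)%:R * pi))) @ \oo --> -oo.
  move=> nk; apply/cvgNry.
  rewrite (_ : - _ = fun n => (x + (k n)%:R * pi) * - (alpha * s)); last first.
    by apply/funext => n; rewrite fctE; ring.
  by apply: cvg_comp (cvg_half_turns x k nk) (gt0_cvgMly _ cvg_id); rewrite oppr_gt0.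
apply: cvgD; apply: cvg_f_comp; apply: rho_cvg1; apply: speed => n.
  by rewrite -addnn leq_addr.
by rewrite leqW// -addnn leq_addr.
Qed.

End half_lines.

(** * Integrals against the occupation measures *)

Section occupation_integrals.
Context {R : realType} (p : R[i]) (alpha : R).
Variables (f : riemann_sphere R -> R) (M : R).
Hypotheses (cf : continuous f) (fM : forall x, `|f x| <= M).
Local Notation leb := (@lebesgue_measure R).
Local Notation S := (borel (riemann_sphere R)).
Local Notation path := (to_sphere \o rho p alpha : measurableTypeR R -> S).

Let continuous_f_path : continuous (fun t => f (to_sphere (rho p alpha t))).
Proof.
have := continuous_f_rho p alpha _ cf 1.
by under eq_fun do rewrite mul1r.
Qed.

(** The measure [mu] coincides with the rescaled image under the path of the
    restriction of Lebesgue measure to [[-T, T]]. *)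
Lemma integral_occupation (T : R) (mu : probability S R) : 0 < T ->
  (forall A : set S, measurable A -> mu A =
    ((2 * T)^-1%:E * leb [set t | (- T <= t <= T)%R /\ A (to_sphere (rho p alpha t))])%E) ->
  \int[mu]_x f x = (2 * T)^-1 * \int[leb]_(t in `[- T, T]) f (path t).
Proof.
move=> T0 muE.
have T2_ge0 : 0 <= (2 * T)^-1 by rewrite invr_ge0 mulr_ge0// ltW.
have mI : measurable (`[- T, T]%classic : set R) by [].
pose nu : {measure set (measurableTypeR R) -> \bar R} := mrestr leb mI.
pose m : {measure set S -> \bar R} :=
  measure_function.measure_function_pushforward__canonical__measure_function_Measure
    nu (measurable_rho p alpha : measurable_fun setT path).
have mpath : measurable_fun setT path := measurable_rho p alpha.
have nuoo : (nu setT < +oo)%E.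
  by rewrite /nu/= /mrestr setTI lebesgue_measure_itv/=; case: ifP => _; rewrite ?ltry.
have moo : (m setT < +oo)%E by rewrite /m/= /pushforward preimage_setT.
have mf : measurable_fun setT (EFin \o f : S -> \bar R).
  by apply/measurable_EFinP; exact: continuous_borel_measurable.
have mg : measurable_fun setT ((f : S -> R) \o path).
  apply: measurableT_comp mpath.
  exact: continuous_borel_measurable.
have intg : nu.-integrable setT (EFin \o (f \o path)).
  apply: measurable_bounded_integrable => //.
  exists M; split; first exact: num_real.
  by move=> y My t _; exact: le_trans (fM _) (ltW My).
rewrite /Rintegral.
rewrite (@eq_measure_integral _ _ _ _ (mscale (NngNum T2_ge0) m)); last first.
  move=> A mA _; apply: (etrans (muE A mA)).
  by rewrite [[set t | _]](_ : _ = path @^-1` A `&` `[- T, T]%classic)// setIC.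
rewrite integral_mscale//; last exact: bounded_borel_integrable moo cf fM.
rewrite (integral_pushforward mpath mf intg)// preimage_setT.
(* The integral for [nu] over the whole line is the integral over [[-T, T]],
   where [nu] agrees with Lebesgue measure. *)
rewrite (@negligible_integral _ (measurableTypeR R) R nu _ (~` `[- T, T]%classic))//;
  last 2 first.
- exact: measurableC.
- by rewrite /nu/= /mrestr setICl measure0.
rewrite setTD setCK.
rewrite (@eq_measure_integral _ (measurableTypeR R) R _ leb nu); last first.
  by move=> A mA AI; rewrite /nu/= /mrestr; congr (leb _); exact/setIidPl.
rewrite fineM//; apply: (@integrable_fin_num _ (measurableTypeR R) R leb) => //.
exact: (continuous_integrable_itv (- T) T continuous_f_path).
Qed.

Lemma integral_occupation_half_lines (T : R) : 0 < T ->
  \int[leb]_(t in `[- T, T]) f (path t) =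
  \int[leb]_(t in `[0, T]) f (to_sphere (rho p alpha (1 * t))) +
  \int[leb]_(t in `[0, T]) f (to_sphere (rho p alpha (-1 * t))).
Proof.
move=> T0; pose g t := f (path t).
have cg : continuous g := continuous_f_path.
rewrite -/g -[LHS](subrK (\int[leb]_(t in `[- T, 0]) g t)).
rewrite Rintegral_itv_split ?oppr_le0 ?ltW//; congr (_ + _).
  by apply: eq_Rintegral => t _; rewrite mul1r.
have := @integration_by_substitution_oppr R g 0 T (ltW T0).
rewrite oppr0 /Rintegral => ->; last exact: continuous_subspaceT.
by congr fine; apply: eq_integral => t _; rewrite mulN1r.
Qed.

Lemma integral_limit_law : \int[limit_law R]_x f x =
  f (to_sphere 0) / 4 + f (to_sphere 1) / 2 + f infty / 4.
Proof.
have mf : measurable_fun setT (EFin \o f : S -> \bar R).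
  by apply/measurable_EFinP; exact: continuous_borel_measurable.
have fi (m : {measure set S -> \bar R}) : (m setT < +oo)%E ->
    m.-integrable setT (EFin \o f) by move=> moo; exact: bounded_borel_integrable moo cf fM.
have di (z : S) : (\d_z : {measure set S -> \bar R}).-integrable setT (EFin \o f).
  by apply: fi; rewrite /= diracT ltry.
have si (k : {nonneg R}) (z : S) : (mscale k \d_z setT < +oo)%E.
  by rewrite /mscale/= diracT mule1 ltry.
have ai (m1 m2 : {measure set S -> \bar R}) : (m1 setT < +oo)%E ->
    (m2 setT < +oo)%E -> (measure_add m1 m2 setT < +oo)%E.
  by move=> m1oo m2oo; rewrite measure_addE lte_add_pinfty.
rewrite /Rintegral /= /limit_measure.
rewrite integral_measure_add//; last 2 first.
- by apply: fi; apply: ai; exact: si.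
- by apply: fi; exact: si.
rewrite integral_measure_add//; [|by apply: fi; exact: si..].
rewrite !integral_mscale// !integral_dirac// !diracT !mul1e/=.
by rewrite ![_^-1 * _]mulrC.
Qed.

End occupation_integrals.

Theorem theorem7 (R : realType) (p : R[i]) (alpha : R)
    (alpha_neq0 : alpha != 0)
    (mu : R -> probability (borel (riemann_sphere R)) R)
    (muE : forall T : R, 1 < T ->
      forall A : set (borel (riemann_sphere R)), measurable A ->
      mu T A =
      ((2 * T)^-1%:E * lebesgue_measure
         [set t : R | (- T <= t <= T)%R /\ A (to_sphere (rho p alpha t))])%E) :
  mu T @[T --> +oo] -->
    (limit_law R : weak_star_probability R (riemann_sphere R)).
Proof.
apply: cvg_initial; apply: cvg_ptws => f.
have cf : continuous (f : riemann_sphere R -> R) := @cts_fun _ _ f.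
have [M fM] := compact_continuous_bounded _ one_point_compactification_compact cf.
rewrite /integral_pairing (integral_limit_law _ M)//.
pose half s T := T^-1 *
  \int[@lebesgue_measure R]_(t in `[0, T]) f (to_sphere (rho p alpha (s * t))).
have : (fun T => (half 1 T + half (-1) T) / 2) @ +oo -->
    (f (to_sphere 0) / 4 + f (to_sphere 1) / 2 + f infty / 4).
  rewrite (_ : _ + _ = ((f (to_sphere 0) + f infty) / 2 + f (to_sphere 1)) / 2); last by field.
  apply: cvgMl.
  have n1 : (-1 : R) ^+ 2 = 1 by rewrite sqrrN expr1n.
  have [a0|a0] : alpha < 0 \/ 0 < alpha.
    by move: alpha_neq0; rewrite neq_lt => /orP[]; [left|right].
  - rewrite addrC; apply: cvgD.
      by apply: (mean_contracting _ _ _ M) => //; rewrite ?expr1n ?mulr1.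
    by apply: (mean_expanding _ _ _ M) => //; rewrite mulrN1 oppr_gt0.
  - apply: cvgD.
      by apply: (mean_expanding _ _ _ M) => //; rewrite ?expr1n ?mulr1.
    by apply: (mean_contracting _ _ _ M) => //; rewrite mulrN1 oppr_lt0.
apply: cvg_trans; apply: near_eq_cvg; near=> T.
have T1 : 1 < T by near: T; exact: nbhs_pinfty_gt.
have T0 : 0 < T := lt_trans ltr01 T1.
rewrite /= (integral_occupation p alpha _ M cf fM T (mu T) T0 (muE T T1)).
rewrite (integral_occupation_half_lines p alpha _ cf T T0) /half.
by field; rewrite gt_eqF.
Unshelve. all: by end_near. Qed.
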